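(* Let $\mathcal G$ be an undirected connected graph with $N$ nodes and Laplacian eigenvalues $\lambda_1\ge\cdots\ge\lambda_{N-1}>\lambda_N=0$. Let $\gamma:=1/\lambda_1$ and $\varpi:=1/2$ (so that the admissible range of the learning rate is $\eta\in(0,1)$), and assume that $b_{N-1}:=\lambda_{N-1}/\lambda_1\in(0,1/2)$. Then the optimal learning rate, i.e., the minimizer of the linear convergence-rate factor $\varrho$ over $(0,1)$, is $$\eta_*:=\arg\min_{\eta\in(0,1)}\varrho(\eta)=-b_{N-1}+\sqrt{2b_{N-1}}\,.$$
   Context: The graph Laplacian is $\mathbf L=\mathrm{diag}(\mathbf W\mathbf 1_N)-\mathbf W$, with $\mathbf W$ the $0/1$ adjacency matrix (zero diagonal). For parameters $\gamma,\varpi,\eta$ define, for $n\in\{1,\ldots,N\}$, $p_n=2-\eta-\gamma\lambda_n$, $q_n=\varpi\gamma\lambda_n+\eta-1$, and $$\varrho(\eta)=\max\Bigl\{\max_{n\in\{1,\ldots,N-1\}}\tfrac12\bigl|p_n+\sqrt{p_n^2+4q_n}\bigr|,\;1-\eta\Bigr\},$$ where $|\cdot|$ is the complex modulus and, for $x<0$, $\sqrt x=\mathrm i\sqrt{|x|}$. The general admissible range of $\eta$ is $(0,2(1-\varpi))$. The quantity $\varrho(\eta)$ governs the rates $\mathcal O(m\varrho^m(\eta))$ of the consensus recursions of the form $x_{m+1}=x_m-(A_\varpi x_{m-1}-\eta x_{m-1})+(Ax_m-\eta x_m)$ with $A=\mathbf I_N-\gamma\mathbf L$, $A_\varpi=\varpi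 A+(1-\varpi)\mathbf I_N$. *)

(* Defs.v *)
From HB Require Import structures.
From mathcomp Require Import all_boot all_order all_algebra.
From mathcomp Require Import reals complex.

Set Implicit Arguments.
Unset Strict Implicit.
Unset Printing Implicit Defensive.

Import Order.TTheory GRing.Theory Num.Theory.

Local Open Scope ring_scope.
Local Open Scope complex_scope.

Definition simple_graph (N : nat) (e : rel 'I_N) : Prop :=
  symmetric e /\ irreflexive e.

Definition connected_graph (N : nat) (e : rel 'I_N) : Prop :=
  forall i j : 'I_N, connect e i j.

Definition adjacency (R : realType) (N : nat) (e : rel 'I_N) : 'M[R]_N :=
  \matrix_(i, j) (e i j)%:R.

Definition laplacian (R : realType) (N : nat) (e : rel 'I_N) : 'M[R]_N :=
  diag_mx (adjacency R e *m (const_mx 1 : 'cV[R]_N))^T - adjacency R e.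

(* [lam 1 >= ... >= lam N] are the eigenvalues of [A], counted with algebraic
   multiplicity; the values of [lam] outside [1 .. N] are irrelevant. *)
Definition ordered_eigenvalues (R : realType) (N : nat) (A : 'M[R]_N)
    (lam : nat -> R) : Prop :=
  char_poly A = \prod_(1 <= n < N.+1) ('X - (lam n)%:P) /\
  (forall m n : nat, (1 <= m <= n)%N -> (n <= N)%N -> lam n <= lam m).

(* The square root of a real as a complex number: [Num.sqrt] is [0] on negative
   reals, so the branch [i * sqrt |x|] has to be written out. *)
Definition csqrt (R : realType) (x : R) : R[i] :=
  if 0 <= x then (Num.sqrt x)%:C else 0 +i* Num.sqrt `|x|.

Section Rate.

Variables (R : realType) (gamma varpi : R).

Definition pcoef (eta l : R) : R := 2 - eta - gamma * l.

Definition qcoef (eta l : R) : R := varpi * gamma * l + eta - 1.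

Definition root_modulus (eta l : R) : R :=
  2^-1 * ComplexField.Normc.normc
    ((pcoef eta l)%:C + csqrt (pcoef eta l ^+ 2 + 4 * qcoef eta l)).

(* The moduli being nonnegative, starting the iterated maximum at [0] is
   harmless as soon as [1 < N]. *)
Definition rate (N : nat) (lam : nat -> R) (eta : R) : R :=
  Num.max (\big[Num.max/0]_(1 <= n < N) root_modulus eta (lam n)) (1 - eta).

Definition admissible_range : interval R := `]0, 2 * (1 - varpi)[.

End Rate.

Definition is_minimizer (R : realType) (f : R -> R) (D : interval R) (x : R)
    : Prop :=
  x \in D /\ (forall y : R, y \in D -> f x <= f y).

(* Main.v *)
Require Import Defs.
From mathcomp Require Import all_boot all_order all_algebra.
From mathcomp Require Import reals complex.
From mathcomp Require Import ring lra.
Import Order.TTheory GRing.Theory Num.Theory.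
Local Open Scope ring_scope.

(** Put [a = gamma * l] and [s = eta + a]. For [varpi = 1/2] the discriminant
    is [s ^ 2 - 2 a]: the dominant root is real for [s >= sqrt (2 a)], of
    modulus [1 - (s - sqrt (s ^ 2 - 2 a)) / 2], increasing in [eta], and
    complex otherwise, of modulus [sqrt (1 - eta - a / 2)], decreasing in
    [eta]. Hence for [a = b] the modulus has its strict minimum [1 - c / 2],
    with [c = sqrt (2 b)], where the discriminant vanishes, i.e. at
    [eta = c - b]; there the larger eigenvalues and the term [1 - eta] do not
    exceed [1 - c / 2], so this is also the strict minimum of the rate. The
    only spectral facts needed are the ordering of the eigenvalues and
    [lam 1 > 0], which follows from [0 < b < 1 / 2]. *)

Lemma discriminant_half (R : realType) (gamma eta l : R) :
  pcoef gamma eta l ^+ 2 + 4 * qcoef gamma (1 / 2) eta l =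
  (eta + gamma * l) ^+ 2 - 2 * (gamma * l).
Proof. by rewrite /pcoef /qcoef; field. Qed.

Lemma root_modulus_real (R : realType) (gamma eta l : R) :
  eta + gamma * l <= 2 ->
  0 <= (eta + gamma * l) ^+ 2 - 2 * (gamma * l) ->
  root_modulus gamma (1 / 2) eta l =
  2^-1 * (2 - (eta + gamma * l) +
          Num.sqrt ((eta + gamma * l) ^+ 2 - 2 * (gamma * l))).
Proof.
move=> s_le2 disc_ge0.
rewrite /root_modulus discriminant_half /csqrt disc_ge0 /= addr0 expr0n addr0.
rewrite sqrtr_sqr ger0_norm /pcoef; first by congr (_ * (_ + _)); ring.
by apply: addr_ge0; [lra | exact: sqrtr_ge0].
Qed.

(** The two roots are conjugate, so the squared modulus is their product, [- qcoef]. *)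
Lemma root_modulus_complex (R : realType) (gamma eta l : R) :
  (eta + gamma * l) ^+ 2 - 2 * (gamma * l) < 0 ->
  root_modulus gamma (1 / 2) eta l = Num.sqrt (1 - eta - gamma * l / 2).
Proof.
move=> disc_lt0.
rewrite /root_modulus discriminant_half /csqrt leNgt disc_lt0 /= addr0 add0r.
rewrite sqr_sqrtr ?normr_ge0 // ltr0_norm //.
have -> : pcoef gamma eta l ^+ 2 -
    ((eta + gamma * l) ^+ 2 - 2 * (gamma * l)) =
    2 ^+ 2 * (1 - eta - gamma * l / 2) by rewrite /pcoef; field.
by rewrite sqrtrM ?sqr_ge0 // sqrtr_sqr ger0_norm // mulKf // pnatr_eq0.
Qed.

(** Here [c ^+ 2 / 2] plays the role of b, so s - c = a - b at this [eta]. In the real case (s -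
    c)^2 exceeds the discriminant by 2 (a - b) (1 - c) >= 0; in the complex case a >= b bounds the
    radicand by (1 - c / 2)^2. *)
Lemma root_modulus_le (R : realType) (gamma l c : R) :
  0 <= c <= 1 -> c ^+ 2 / 2 <= gamma * l <= 1 ->
  root_modulus gamma (1 / 2) (c - c ^+ 2 / 2) l <= 1 - c / 2.
Proof.
move=> /andP[c0 c1] /andP[ca a1]; set eta := c - _.
have [disc_ge0|disc_lt0] := leP 0 ((eta + gamma * l) ^+ 2 - 2 * (gamma * l)).
  rewrite root_modulus_real //; last by rewrite /eta; nra.
  suff: Num.sqrt ((eta + gamma * l) ^+ 2 - 2 * (gamma * l)) <=
        eta + gamma * l - c by lra.
  have sc_ge0 : 0 <= eta + gamma * l - c by rewrite /eta; lra.
  rewrite -[leRHS]ger0_norm // -sqrtr_sqr ler_wsqrtr // -subr_ge0.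
  have -> : (eta + gamma * l - c) ^+ 2 -
      ((eta + gamma * l) ^+ 2 - 2 * (gamma * l)) =
      2 * ((gamma * l - c ^+ 2 / 2) * (1 - c)) by rewrite /eta; field.
  by apply: mulr_ge0 => //; apply: mulr_ge0; rewrite subr_ge0.
rewrite root_modulus_complex //.
have r_ge0 : 0 <= 1 - c / 2 by lra.
by rewrite -[leRHS]ger0_norm // -sqrtr_sqr ler_wsqrtr // /eta; lra.
Qed.

(** As 2 a = c^2, the discriminant factors as (s - c) (s + c), and the excluded [eta] is exactly s =
    c. For s > c it is larger than (s - c)^2; for s < c the radicand 1 - s + c^2 / 4 is larger than
    (1 - c / 2)^2. *)
Lemma root_modulus_gt (R : realType) (gamma l c eta : R) :
  0 < c <= 1 -> gamma * l = c ^+ 2 / 2 -> 0 < eta < 1 ->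
  eta != c - c ^+ 2 / 2 ->
  1 - c / 2 < root_modulus gamma (1 / 2) eta l.
Proof.
move=> /andP[c0 c1] aE /andP[eta0 eta1] eta_neq.
have s_gt0 : 0 < eta + gamma * l by rewrite aE; nra.
have sc_gt0 : 0 < eta + gamma * l + c by exact: addr_gt0.
have discE : (eta + gamma * l) ^+ 2 - 2 * (gamma * l) =
    (eta + gamma * l - c) * (eta + gamma * l + c) by rewrite aE; field.
have [disc_ge0|disc_lt0] := leP 0 ((eta + gamma * l) ^+ 2 - 2 * (gamma * l)).
  rewrite root_modulus_real //; last by rewrite aE; nra.
  have s_gtc : c < eta + gamma * l.
    rewrite lt_neqAle; apply/andP; split.
      by apply: contra_neq eta_neq => cE; rewrite {1}cE aE addrK.
    by move: disc_ge0; rewrite discE pmulr_lge0 // subr_ge0.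
  suff: eta + gamma * l - c <
        Num.sqrt ((eta + gamma * l) ^+ 2 - 2 * (gamma * l)) by lra.
  have diff_gt0 : 0 < eta + gamma * l - c by rewrite subr_gt0.
  rewrite -[ltLHS]gtr0_norm // -sqrtr_sqr ltr_sqrt discE ?mulr_gt0 //.
  by rewrite expr2 ltr_pM2l // ltrD2l; lra.
rewrite root_modulus_complex //.
have s_ltc : eta + gamma * l < c.
  by move: disc_lt0; rewrite discE pmulr_llt0 // subr_lt0.
have r_gt0 : 0 < 1 - c / 2 by lra.
have lt_rad : (1 - c / 2) ^+ 2 < 1 - eta - gamma * l / 2.
  by move: s_ltc; rewrite aE; lra.
rewrite -[ltLHS]gtr0_norm // -sqrtr_sqr ltr_sqrt //.
by apply: lt_trans lt_rad; rewrite exprn_gt0.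
Qed.

Lemma root_modulus_le_rate (R : realType) (gamma varpi : R) (N n : nat)
    (lam : nat -> R) (eta : R) :
  (0 < n < N)%N ->
  root_modulus gamma varpi eta (lam n) <= rate gamma varpi N lam eta.
Proof.
move=> nN; rewrite /rate le_max; apply/orP; left.
apply: (@le_bigmax_seq _ _ _ _ _ n xpredT
  (fun k => root_modulus gamma varpi eta (lam k))) => //.
by rewrite mem_index_iota.
Qed.

(** The condition [0 <= r] takes care of the initial value [0] of the iterated maximum. *)
Lemma rate_le (R : realType) (gamma varpi : R) (N : nat)
    (lam : nat -> R) (eta r : R) :
  0 <= r -> 1 - eta <= r ->
  (forall n, (0 < n < N)%N -> root_modulus gamma varpi eta (lam n) <= r) ->
  rate gamma varpi N lam eta <= r.
Proof.
move=> r0 eta_r mod_r; rewrite /rate ge_max eta_r andbT big_seq.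
by apply: bigmax_le => // n; rewrite mem_index_iota; apply: mod_r.
Qed.

Theorem theorem6 (R : realType) (N : nat) (e : rel 'I_N) (lam : nat -> R) :
  (1 < N)%N ->
  simple_graph e ->
  connected_graph e ->
  ordered_eigenvalues (laplacian R e) lam ->
  let gamma : R := 1 / lam 1%N in
  let varpi : R := 1 / 2 in
  let b : R := lam N.-1 / lam 1%N in
  0 < b < 1 / 2 ->
  admissible_range varpi = (`]0, 1[) /\
  (forall eta : R,
     is_minimizer (rate gamma varpi N lam) (`]0, 1[) eta <->
     eta = - b + Num.sqrt (2 * b)).
Proof.
move=> N_gt1 _ _ [_ lam_ord] gamma varpi b /andP[b_gt0 b_lt].
split.
  by rewrite /admissible_range /varpi; congr (Interval _ (BSide _ _)); field.
have ltN n : (0 < n < N)%N -> (n <= N.-1)%N.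
  by case/andP=> _ nN; rewrite -ltnS (ltn_predK N_gt1).
have N1 : (0 < N.-1 < N)%N.
  by rewrite ltn_predRL N_gt1 ltn_predL ltnW.
have le_last n : (0 < n < N)%N -> lam N.-1 <= lam n.
  by move=> nN; apply: lam_ord; rewrite ?leq_pred // ltN // andbT; case/andP: nN.
have le_first n : (0 < n < N)%N -> lam n <= lam 1%N.
  by move=> /andP[n0 nN]; apply: lam_ord; rewrite ?n0 // ltnW.
have lam1_gt0 : 0 < lam 1%N.
  rewrite ltNge; apply/negP => lam1_le0.
  (* If [lam 1] were [0], then [b] would be [0], by the convention that [0] has inverse [0]. *)
  have lam1_lt0 : lam 1%N < 0.
    rewrite lt_neqAle lam1_le0 andbT; apply/eqP => lam10.
    by move: b_gt0; rewrite /b lam10 invr0 mulr0 ltxx.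
  (* Dividing [lam N.-1 <= lam 1] by a negative number reverses it. *)
  have : 1 <= b by rewrite /b ler_ndivlMr // mul1r le_first.
  by lra.
have gammaE l : gamma * l = l / lam 1%N by rewrite /gamma div1r mulrC.
set c := Num.sqrt (2 * b).
have c2 : c ^+ 2 = 2 * b by rewrite sqr_sqrtr // mulr_ge0 // ltW.
have bE : b = c ^+ 2 / 2 by rewrite c2; field.
have c_gt0 : 0 < c by rewrite sqrtr_gt0 mulr_gt0.
have c_lt1 : c < 1 by nra.
have -> : - b + c = c - c ^+ 2 / 2 by rewrite bE addrC.
set eta_opt := c - _.
have opt_in : eta_opt \in `]0, 1[.
  by rewrite in_itv /= /eta_opt; apply/andP; split; nra.
have rate_opt : rate gamma varpi N lam eta_opt <= 1 - c / 2.
  (* The bound on [1 - eta_opt] amounts to c^2 <= c. *)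
  apply: rate_le => [||n nN]; rewrite ?/eta_opt; [lra | nra |].
  apply: root_modulus_le; first by rewrite !ltW.
  rewrite gammaE -bE ler_pM2r ?invr_gt0 // le_last //=.
  by rewrite ler_pdivrMr // mul1r le_first.
have rate_gt eta : eta \in `]0, 1[ -> eta != eta_opt ->
    1 - c / 2 < rate gamma varpi N lam eta.
  rewrite in_itv /= => eta01 eta_neq.
  (* The single eigenvalue [lam N.-1], for which a = b, already forces the strict bound. *)
  apply: lt_le_trans (root_modulus_le_rate R gamma varpi _ _ lam eta N1).
  apply: root_modulus_gt => //; first by rewrite c_gt0 ltW.
  by rewrite gammaE -bE.
move=> eta; split=> [[eta_in eta_min]|->].
  apply/eqP/negPn/negP => /(rate_gt _ eta_in).
  by rewrite ltNge (le_trans (eta_min _ opt_in)).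
split=> // y y_in; have [->//|/(rate_gt _ y_in)/ltW] := eqVneq y eta_opt.
exact: le_trans.
Qed.
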